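(* Let $k_3$ denote the supremum of the average degrees of the contact graphs of all finite packings of closed balls (of arbitrary, possibly different, positive radii) in $\mathbb{R}^3$. Then $$k_3 < 13.92.$$
   Context: A packing of closed balls in $\mathbb{R}^d$ is a (nonempty) finite set of closed balls of positive radii with pairwise disjoint interiors; the radii need not be equal. The contact graph of a packing has the balls of the packing as vertices, two vertices being joined by an edge if and only if the corresponding balls are tangent. The average degree of a graph $G=(V,E)$ is $k(G)=2|E|/|V|$. Then $k_d=\sup_G k(G)$, where $G$ ranges over all contact graphs of packings of closed balls in $\mathbb{R}^d$. *)

(* Defs.v *)
From HB Require Import structures.
From mathcomp Require Import all_boot all_order all_algebra.
From mathcomp Require Import finmap.
From mathcomp Require Import all_classical all_reals.
From mathcomp Require Import ereal topology normedtype.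

Set Implicit Arguments.
Unset Strict Implicit.
Unset Printing Implicit Defensive.

Import Order.TTheory GRing.Theory Num.Theory.
Import numFieldNormedType.Exports.

Local Open Scope classical_set_scope.
Local Open Scope ring_scope.

Section Graph.
Variables (V : finType) (adj : rel V).

Definition edges : {set {set V}} :=
  [set E : {set V} | [exists u, exists v,
    [&& u != v, adj u v & E == [set u; v]%SET]]]%SET.

Definition average_degree (R : realType) : R :=
  (2 * #|edges|)%N%:R / #|V|%:R.

End Graph.

Section BallPacking.
Variables (R : realType) (d : nat).

(* The norm [`| x |] that the library puts on ['rV[R]_d] is the sup norm, so
   the Euclidean distance is spelled out.  Both norms induce the library's
   (product) topology, which gives the meaning of [interior] below. *)
Definition edist (x y : 'rV[R]_d) : R :=
  Num.sqrt (\sum_(i < d) (x ord0 i - y ord0 i) ^+ 2).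

(* A ball is encoded as the pair (centre, radius).  For [0 < d] this is
   faithful: a ball of positive radius determines its centre and radius. *)
Local Notation ball_data := ('rV[R]_d * R)%type.

Definition eball (b : ball_data) : set 'rV[R]_d :=
  [set x | edist b.1 x <= b.2].

Definition is_packing (P : {fset ball_data}) : Prop :=
  [/\ (0 < #|` P|)%N,
      forall b, b \in P -> 0 < b.2 &
      forall b c, b \in P -> c \in P -> b != c ->
        interior (eball b) `&` interior (eball c) = set0].

(* Tangency is external: the two balls meet in exactly one point. *)
Definition tangent (b c : ball_data) : Prop :=
  exists p, eball b `&` eball c = [set p].

Definition contact_graph (P : {fset ball_data}) : rel P :=
  fun b c => `[< tangent (val b) (val c) >].

End BallPacking.

(* The supremum is taken in the extended reals, where it always exists: a real
   upper bound on it thus includes the boundedness of the average degrees. *)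
Definition kd (R : realType) (d : nat) : \bar R :=
  ereal_sup [set (average_degree (@contact_graph R d P) R)%:E
            | P in [set P : {fset 'rV[R]_d * R} | is_packing P]].

(* Main.v *)
(* Delsarte's linear programming method with varying radii.  Let a ball of
   radius [r] be touched by balls of radii [r_i] in the directions [u_i], and
   put [s_i = r_i / (r + r_i)].  Disjointness of the interiors says that
   [u_i . u_j <= 1 - 2 s_i s_j], and the two ratios attached to an edge of the
   contact graph sum to [1].  Hence, if [w] is a nonnegative weight with
   [w(s) + w(1 - s) >= 1] and [\sum_i w(s_i) <= M] around every ball, then
   [#|E| <= M * #|V|].

   Such a bound follows from a positive semidefinite kernel.  If
   [F(x; s, t) = 1 + \sum_k P_k(x) \sum_l l(s) l(t)], with Legendre
   polynomials [P_k] and [l] ranging over a finite set of functions depending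
   on [k], is nonpositive for [-1 <= x <= 1 - 2 s t], and if
   [w(s) F(1; s, s) <= M], then
   [(\sum_i w(s_i))^2 <= \sum_(i, j) w(s_i) w(s_j) F(u_i . u_j; s_i, s_j)
      <= \sum_i w(s_i)^2 F(1; s_i, s_i) <= M \sum_i w(s_i)].

   The separation condition weakens when the [s_i] are rounded down to
   multiples of [1/90], so only finitely many pairs [(s, t)] matter, and for
   each of them nonpositivity is a statement about a polynomial in one
   variable.  The kernel below gives [M = 139/20], so the average degree is at
   most [13.9]. *)
Require Import Defs.
From Stdlib Require Import ZArith Lia.
From mathcomp Require Import all_boot all_order all_algebra.
From mathcomp Require Import finmap.
From mathcomp Require Import all_classical all_reals.
From mathcomp Require Import ereal topology normedtype realfun.
From mathcomp Require Import zify ssrZ ring lra.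

Set Implicit Arguments.
Unset Strict Implicit.
Unset Printing Implicit Defensive.

Import Order.TTheory GRing.Theory Num.Theory.
Import numFieldNormedType.Exports.

Local Open Scope classical_set_scope.
Local Open Scope ring_scope.

(** * Integer forms in two variables and a sign test on an interval *)

Section HomogeneousPolynomials.
Variable R : realFieldType.

(** Coefficients stay in [Z] so that [vm_compute] can check them; [zr] carries the result to [R]. *)
Definition zr (z : Z) : R := (int_of_Z z)%:~R.

Lemma zrD a b : zr (Z.add a b) = zr a + zr b.
Proof. by rewrite /zr -intrD -rmorphD. Qed.

Lemma zrM a b : zr (Z.mul a b) = zr a * zr b.
Proof. by rewrite /zr -intrM -rmorphM. Qed.

Lemma zrN a : zr (Z.opp a) = - zr a.
Proof. by apply/eqP; rewrite -addr_eq0 -zrD Z.add_opp_diag_l. Qed.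

Lemma zr0 : zr Z0 = 0. Proof. by []. Qed.

Lemma zr_nat n : zr (Z.of_nat n) = n%:R.
Proof. by rewrite /zr -[Z.of_nat n]/(Z_of_int (Posz n)) Z_of_intK. Qed.

Lemma zr_gt0 p : 0 < zr (Zpos p).
Proof. by rewrite /zr /= ltr0n; apply/ssrnat.ltP; lia. Qed.

Lemma zr_le a b : Z.leb a b -> zr a <= zr b.
Proof.
move=> ab; rewrite /zr ler_int -subr_ge0 -rmorphB.
have : Z.leb Z0 (b - a)%R by rewrite /GRing.add /GRing.opp /=; lia.
by case: (b - a)%R.
Qed.

(* The value at [(x, y)] of the form [\sum_i p_i x^i y^(size p - 1 - i)]. *)
Fixpoint hev (p : seq Z) (x y : R) : R :=
  if p is c :: q then zr c * y ^+ size q + x * hev q x y else 0.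

Fixpoint add_coefs (p q : seq Z) : seq Z :=
  match p, q with
  | [::], _ => q
  | _, [::] => p
  | a :: p', b :: q' => Z.add a b :: add_coefs p' q'
  end.

Fixpoint shift_coefs (p : seq Z) : seq Z :=
  if p is c :: q then
    let r := shift_coefs q in add_coefs (c :: r) (rcons r Z0)
  else [::].

Fixpoint dilate (w a : Z) (p : seq Z) : seq Z :=
  if p is c :: q then Z.mul w c :: dilate (Z.mul w a) a q else [::].

Lemma size_add_coefs p q : size p = size q -> size (add_coefs p q) = size p.
Proof. by elim: p q => [|a p IH] [|b q] //= [/IH ->]. Qed.

Lemma hev_add_coefs p q x y :
  size p = size q -> hev (add_coefs p q) x y = hev p x y + hev q x y.
Proof.
elim: p q => [|a p IH] [|b q] //=; first by rewrite addr0.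
by case=> spq; rewrite IH // size_add_coefs // zrD -spq; ring.
Qed.

Lemma hev_rcons p c x y :
  hev (rcons p c) x y = y * hev p x y + zr c * x ^+ size p.
Proof.
elim: p => [|a p IH] /=; first by rewrite !mulr0 add0r addr0 expr0.
by rewrite IH size_rcons !exprS; ring.
Qed.

Lemma hev_rev p x y : hev (rev p) x y = hev p y x.
Proof.
elim: p => [|c p IH] //=.
by rewrite rev_cons hev_rcons size_rev IH; ring.
Qed.

Lemma size_shift_coefs p : size (shift_coefs p) = size p.
Proof.
elim: p => [|c p IH] //.
rewrite -[LHS]/(size (add_coefs (c :: _) (rcons _ _))).
by rewrite size_add_coefs /= ?size_rcons IH.
Qed.

Lemma hev_shift_coefs p x y : hev (shift_coefs p) x y = hev p (x + y) y.
Proof.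
elim: p => [|c p IH] //.
rewrite -[LHS]/(hev (add_coefs (c :: shift_coefs p) (rcons (shift_coefs p) Z0)) x y).
rewrite hev_add_coefs ?size_rcons //= hev_rcons IH size_shift_coefs zr0; ring.
Qed.

Lemma hev_map a p x y : hev [seq Z.mul a d | d <- p] x y = zr a * hev p x y.
Proof.
elim: p => [|c p IH] /=; first by rewrite mulr0.
by rewrite IH size_map zrM; ring.
Qed.

Lemma hev_dilate w a p x y : hev (dilate w a p) x y = zr w * hev p (zr a * x) y.
Proof.
elim: p w => [|c p IH] w /=; first by rewrite mulr0.
rewrite IH !zrM.
have -> : size (dilate (Z.mul w a) a p) = size p.
  by elim: p {IH} (Z.mul w a) => //= _ p IH ?; rewrite IH.
ring.
Qed.

Lemma hev_le0 p x y :
  0 <= x -> 0 <= y -> all (fun c => Z.leb c Z0) p -> hev p x y <= 0.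
Proof.
move=> x0 y0; elim: p => [|c p IH] //= /andP[c0 /IH p0].
rewrite -[0]addr0 lerD //.
  by rewrite mulr_le0_ge0 ?exprn_ge0 // -zr0 zr_le.
by rewrite mulr_ge0_le0.
Qed.

(* The coefficients of [shift_coefs (rev p)] are, up to positive factors, the
   Bernstein coefficients of [p] on [[0, 1]]. *)
Fixpoint nonpos_on01 (fuel : nat) (p : seq Z) : bool :=
  let r := rev p in
  if all (fun c => Z.leb c Z0) (shift_coefs r) then true else
  if fuel is n.+1 then
    let q := rev (dilate (Zpos xH) (Zpos (xO xH)) r) in
    if nonpos_on01 n q then nonpos_on01 n (shift_coefs q) else false
  else false.

(** In the nonnegative variables [y - x] and [x] the form has the tested coefficients. If some are
    positive, the interval of ratios [x / y] is halved: [q] covers the left half and its shift the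
    right half. *)
Lemma nonpos_on01P n p x y :
  nonpos_on01 n p -> 0 <= x -> x <= y -> hev p x y <= 0.
Proof.
elim: n p x y => [|n IH] p x y /=; case: ifP => // pos.
1,2: move=> _ x0 xy; rewrite -hev_rev -[y in hev _ y](subrK x).
1,2: by rewrite -hev_shift_coefs hev_le0 // subr_ge0.
set q := rev _; case: ifP => // ql qr x0 xy.
have -> : hev p x y = hev q x (y / 2).
  rewrite hev_rev hev_dilate hev_rev mul1r; congr hev.
  by rewrite -[zr _]/(2 : R); field.
have [xy2|xy2] := leP x (y / 2); first exact: (IH).
rewrite -[x](subrK (y / 2)) -hev_shift_coefs; apply: IH => //; lra.
Qed.

End HomogeneousPolynomials.

(** * Numerical data of the kernel and their verification *)

Module Certificate.
Local Open Scope Z_scope.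

(* Row [k] holds the coefficients of [16 * P_(k+1)], [P_k] being the Legendre
   polynomial; the rows are padded since [hev] depends on the length. *)
Definition legendre16 : seq (seq Z) := [::
  [:: 0; 16; 0; 0; 0; 0; 0; 0];
  [:: -8; 0; 24; 0; 0; 0; 0; 0];
  [:: 0; -24; 0; 40; 0; 0; 0; 0];
  [:: 6; 0; -60; 0; 70; 0; 0; 0];
  [:: 0; 30; 0; -140; 0; 126; 0; 0];
  [:: -5; 0; 105; 0; -315; 0; 231; 0];
  [:: 0; -35; 0; 315; 0; -693; 0; 429]].

(* [(k, l)] stands for the function [l(n - 45) / (10^4 n^2)] of the grid point
   [n / 90], to be paired with row [k] of [legendre16].  The coefficients are a
   rounded numerical solution of the semidefinite program minimising [M]. *)
Definition features : seq (nat * seq Z) := [::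
  (0%N, [:: 34184454; 1293906; 12050; -145]);
  (0%N, [:: 0; 160453; 3278; 235]);
  (0%N, [:: 0; 0; 11551; -478]);
  (1%N, [:: 39646533; 1093645; 4169; -408]);
  (1%N, [:: 0; 33897; 10877; -975]);
  (2%N, [:: 37130500; 520550; -4833; -637]);
  (2%N, [:: 0; 111010; 20659; -1012]);
  (3%N, [:: 27723686; -149672; -9584; -780]);
  (3%N, [:: 0; 226658; 22672; -1251]);
  (4%N, [:: 14910900; -665069; -8367; -896]);
  (4%N, [:: 0; 266343; 22820; -1226]);
  (5%N, [:: 3708150; -778895; -507; -922]);
  (5%N, [:: 0; 135832; 8402; -1033]);
  (6%N, [:: 1552257; 346459; -8012; 1399])].

Definition scale2 : Z := 100000000.

Definition feature_at (l : seq Z) (n : nat) : Z :=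
  foldr (fun c v => c + (Z.of_nat n - 45) * v) 0 l.

(* The function [F] at [s = n / 90] and [t = m / 90], multiplied by
   [16 * scale2 * n^2 * m^2]. *)
Definition kernel (n m : nat) : seq Z :=
  foldr (fun f p => add_coefs [seq feature_at f.2 n * feature_at f.2 m * c
                         | c <- nth [::] legendre16 f.1] p)
        (16 * scale2 * (Z.of_nat n * Z.of_nat n) * (Z.of_nat m * Z.of_nat m)
           :: nseq 7 0)
        features.

(* The substitution [x = -1 + 2 (1 - n m / 90 ^ 2) u] maps [[0, 1]] onto
   [[-1, 1 - 2 (n / 90) (m / 90)]]. *)
Definition kernel_ok (n m : nat) : bool :=
  let p := shift_coefs (dilate 1 (-1) (kernel n m)) in
  let q := dilate 1 (- (2 * (8100 - Z.of_nat n * Z.of_nat m))) p in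
  nonpos_on01 8 (rev (dilate 1 8100 (rev q))).

(* [w(s) F(1; s, s) <= M] at [s = n / 90], with [w(s) = (n - 25) / 39] and
   [5421 / 20 = 39 * M]. *)
Definition diagonal_ok (n : nat) : bool :=
  let s := scale2 * (Z.of_nat n * Z.of_nat n) * (Z.of_nat n * Z.of_nat n) in
  Z.leb (20 * Z.of_nat (n - 25) *
           foldr (fun f v => feature_at f.2 n * feature_at f.2 n + v) s features)
        (5421 * s).

(** The weight vanishes up to grid point 25 and the grid is capped at 64; symmetry leaves the pairs
    with [m <= n]. *)
Lemma kernel_certificate :
  all (fun n => all (kernel_ok n) (iota 26 (n - 25))) (iota 26 39).
Proof. by vm_compute. Qed.

Lemma diagonal_certificate : all diagonal_ok (iota 26 39).
Proof. by vm_compute. Qed.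

End Certificate.

(** * Positive semidefinite kernels and Legendre polynomials on the sphere *)

Section PositiveSemidefinite.
Variables (R : realFieldType) (I : finType).

Definition psd (K : I -> I -> R) :=
  forall c : I -> R, 0 <= \sum_i \sum_j c i * c j * K i j.

Lemma eq_psd K L : (forall i j, K i j = L i j) -> psd K -> psd L.
Proof.
move=> KL psdK c; have := psdK c.
by under eq_bigr => i _ do under eq_bigr => j _ do rewrite KL.
Qed.

Lemma psd0 : psd (fun _ _ => 0).
Proof.
by move=> c; do 2!rewrite sumr_ge0 // => ? _; rewrite mulr0.
Qed.

Lemma psd_rank1 f : psd (fun i j => f i * f j).
Proof.
move=> c; suff -> : \sum_i \sum_j c i * c j * (f i * f j) =
    (\sum_i c i * f i) ^+ 2 by exact: sqr_ge0.
rewrite expr2 mulr_suml; apply: eq_bigr => i _; rewrite mulr_sumr.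
by apply: eq_bigr => j _; ring.
Qed.

Lemma psdD K L : psd K -> psd L -> psd (fun i j => K i j + L i j).
Proof.
move=> pK pL c; under eq_bigr => i _ do
  (under eq_bigr => j _ do rewrite mulrDr; rewrite big_split).
by rewrite big_split addr_ge0.
Qed.

Lemma psdZ w K : 0 <= w -> psd K -> psd (fun i j => w * K i j).
Proof.
move=> w0 pK c; under eq_bigr => i _ do
  (under eq_bigr => j _ do rewrite mulrCA; rewrite -mulr_sumr).
by rewrite -mulr_sumr mulr_ge0.
Qed.

Lemma psd_conj f K : psd K -> psd (fun i j => f i * f j * K i j).
Proof.
move=> pK c; have := pK (fun i => c i * f i); congr (0 <= _).
by apply: eq_bigr => i _; apply: eq_bigr => j _; ring.
Qed.

Variables x y z : I -> R.
Hypothesis unit_xyz : forall i, x i ^+ 2 + y i ^+ 2 + z i ^+ 2 = 1.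

Definition dot3 i j := x i * x j + y i * y j + z i * z j.

(* Real and imaginary parts of [(x + iy) ^ m]. *)
Fixpoint harm (m : nat) (i : I) : R * R :=
  if m is n.+1 then
    let h := harm n i in (x i * h.1 - y i * h.2, x i * h.2 + y i * h.1)
  else (1, 0).

(** The real part of [(x_i + i y_i)^m] times the conjugate of [(x_j + i y_j)^m]. *)
Definition circ m i j := (harm m i).1 * (harm m j).1 + (harm m i).2 * (harm m j).2.

(* The form [rho ^ m * 'T_m(t / rho)] of the Chebyshev polynomial ['T_m],
   where [r = rho ^ 2]. *)
Fixpoint cheb (m : nat) (t r : R) : R :=
  match m with
  | 0 => 1
  | 1 => t
  | (n.+1 as n').+1 => 2 * t * cheb n' t r - r * cheb n t r
  end.

(** Powers of a complex number satisfy the Chebyshev recurrence. Replacing [x^2 + y^2] by [1 - z^2]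
    then turns the addition theorem into a polynomial identity in [z i], [z j] and
    [x i * x j + y i * y j]. *)
Lemma circE m i j :
  circ m i j = cheb m (x i * x j + y i * y j) ((1 - z i ^+ 2) * (1 - z j ^+ 2)).
Proof.
have xyz k : 1 - z k ^+ 2 = x k ^+ 2 + y k ^+ 2 by rewrite -(unit_xyz k) addrK.
rewrite !xyz /circ.
suff : circ m i j = cheb m (x i * x j + y i * y j)
          ((x i ^+ 2 + y i ^+ 2) * (x j ^+ 2 + y j ^+ 2)) /\
       circ m.+1 i j = cheb m.+1 (x i * x j + y i * y j)
          ((x i ^+ 2 + y i ^+ 2) * (x j ^+ 2 + y j ^+ 2)) by case.
elim: m => [|m [IH0 IH1]]; first by rewrite /circ /=; split; ring.
split=> //; rewrite -[RHS]/(2 * _ * cheb m.+1 _ _ - _ * cheb m _ _) -IH1 -IH0.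
rewrite /circ /=; case: (harm m i) (harm m j) => [a b] [c d] /=; ring.
Qed.

(* [\sum_m w_m T_m(z_i) T_m(z_j) circ (m0 + m) i j] for the list [L] of the
   pairs [(w_m, T_m)]. *)
Fixpoint zonal (m0 : nat) (L : seq (R * (R -> R))) (i j : I) : R :=
  if L is (w, T) :: L' then
    w * (T (z i) * T (z j) * circ m0 i j) + zonal m0.+1 L' i j
  else 0.

(** Each [circ] is a sum of two rank one kernels, which the factors [T (z i)] rescale. *)
Lemma psd_zonal m0 L : all (fun wT => 0 <= wT.1) L -> psd (zonal m0 L).
Proof.
elim: L m0 => [|[w T] L IH] m0 /=; first by move=> _; exact: psd0.
case/andP=> w0 /IH pL; apply: psdD => //; apply: psdZ => //.
by apply: (psd_conj (T \o z)); apply: psdD; apply: psd_rank1.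
Qed.

(* The addition theorem: [P_k(u . v)] is the zonal sum in which [T_m] is
   proportional to the [m]-th derivative of [P_k]. *)
Lemma psd_legendre1 : psd (fun i j =>
  let d := dot3 i j in 16 * d).
Proof.
apply: eq_psd (psd_zonal 0 (L := [::
     (16, fun t => t);
     (16, fun t => 1)]) _).
  by move=> i j; rewrite /dot3 /= !circE /=; field.
by rewrite /= ?divr_ge0 ?ler0n.
Qed.

Lemma psd_legendre2 : psd (fun i j =>
  let d := dot3 i j in 24 * d ^+ 2 - 8).
Proof.
apply: eq_psd (psd_zonal 0 (L := [::
     (4, fun t => 3 * t ^+ 2 - 1);
     (48, fun t => t);
     (12, fun t => 1)]) _).
  by move=> i j; rewrite /dot3 /= !circE /=; field.
by rewrite /= ?divr_ge0 ?ler0n.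
Qed.

Lemma psd_legendre3 : psd (fun i j =>
  let d := dot3 i j in 40 * d ^+ 3 - 24 * d).
Proof.
apply: eq_psd (psd_zonal 0 (L := [::
     (4, fun t => 5 * t ^+ 3 - 3 * t);
     (6, fun t => 5 * t ^+ 2 - 1);
     (60, fun t => t);
     (10, fun t => 1)]) _).
  by move=> i j; rewrite /dot3 /= !circE /=; field.
by rewrite /= ?divr_ge0 ?ler0n.
Qed.

Lemma psd_legendre4 : psd (fun i j =>
  let d := dot3 i j in 70 * d ^+ 4 - 60 * d ^+ 2 + 6).
Proof.
apply: eq_psd (psd_zonal 0 (L := [::
     (1 / 4, fun t => 35 * t ^+ 4 - 30 * t ^+ 2 + 3);
     (10, fun t => 7 * t ^+ 3 - 3 * t);
     (5, fun t => 7 * t ^+ 2 - 1);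
     (70, fun t => t);
     (35 / 4, fun t => 1)]) _).
  by move=> i j; rewrite /dot3 /= !circE /=; field.
by rewrite /= ?divr_ge0 ?ler0n.
Qed.

Lemma psd_legendre5 : psd (fun i j =>
  let d := dot3 i j in 126 * d ^+ 5 - 140 * d ^+ 3 + 30 * d).
Proof.
apply: eq_psd (psd_zonal 0 (L := [::
     (1 / 4, fun t => 63 * t ^+ 5 - 70 * t ^+ 3 + 15 * t);
     (15 / 4, fun t => 21 * t ^+ 4 - 14 * t ^+ 2 + 1);
     (105, fun t => 3 * t ^+ 3 - t);
     (35 / 8, fun t => 9 * t ^+ 2 - 1);
     (315 / 4, fun t => t);
     (63 / 8, fun t => 1)]) _).
  by move=> i j; rewrite /dot3 /= !circE /=; field.
by rewrite /= ?divr_ge0 ?ler0n.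
Qed.

Lemma psd_legendre6 : psd (fun i j =>
  let d := dot3 i j in 231 * d ^+ 6 - 315 * d ^+ 4 + 105 * d ^+ 2 - 5).
Proof.
apply: eq_psd (psd_zonal 0 (L := [::
     (1 / 16, fun t => 231 * t ^+ 6 - 315 * t ^+ 4 + 105 * t ^+ 2 - 5);
     (21 / 4, fun t => 33 * t ^+ 5 - 30 * t ^+ 3 + 5 * t);
     (105 / 32, fun t => 33 * t ^+ 4 - 18 * t ^+ 2 + 1);
     (105 / 8, fun t => 11 * t ^+ 3 - 3 * t);
     (63 / 16, fun t => 11 * t ^+ 2 - 1);
     (693 / 8, fun t => t);
     (231 / 32, fun t => 1)]) _).
  by move=> i j; rewrite /dot3 /= !circE /=; field.
by rewrite /= ?divr_ge0 ?ler0n.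
Qed.

Lemma psd_legendre7 : psd (fun i j =>
  let d := dot3 i j in 429 * d ^+ 7 - 693 * d ^+ 5 + 315 * d ^+ 3 - 35 * d).
Proof.
apply: eq_psd (psd_zonal 0 (L := [::
     (1 / 16, fun t => 429 * t ^+ 7 - 693 * t ^+ 5 + 315 * t ^+ 3 - 35 * t);
     (7 / 64, fun t => 429 * t ^+ 6 - 495 * t ^+ 4 + 135 * t ^+ 2 - 5);
     (21 / 32, fun t => 143 * t ^+ 5 - 110 * t ^+ 3 + 15 * t);
     (21 / 64, fun t => 143 * t ^+ 4 - 66 * t ^+ 2 + 3);
     (231 / 16, fun t => 13 * t ^+ 3 - 3 * t);
     (231 / 64, fun t => 13 * t ^+ 2 - 1);
     (3003 / 32, fun t => t);
     (429 / 64, fun t => 1)]) _).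
  by move=> i j; rewrite /dot3 /= !circE /=; field.
by rewrite /= ?divr_ge0 ?ler0n.
Qed.

End PositiveSemidefinite.

(** * The linear programming bound around one ball *)

Section Neighbourhood.
Import Certificate.
Variable R : realType.

Notation hev := (@hev R).
Notation zr := (zr R).

Lemma psd_legendre (I : finType) (x y z : I -> R) k :
  (forall i, x i ^+ 2 + y i ^+ 2 + z i ^+ 2 = 1) ->
  psd (fun i j => hev (nth [::] legendre16 k) (dot3 x y z i j) 1).
Proof.
(* Numerals are unfolded by binary digits into expressions that [ring] understands. *)
move=> u; have zr_xO p : zr (Zpos (xO p)) = 2 * zr (Zpos p).
  by rewrite -[2 : R]/(zr (Zpos (xO xH))) -zrM.
have zr_xI p : zr (Zpos (xI p)) = 2 * zr (Zpos p) + 1.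
  by rewrite -[2 : R]/(zr (Zpos (xO xH))) -[1 in RHS]/(zr (Zpos xH)) -zrM -zrD.
have zr_neg p : zr (Zneg p) = - zr (Zpos p) by rewrite -zrN.
have zr_xH : zr (Zpos xH) = 1 by [].
case: k => [|[|[|[|[|[|[|k]]]]]]] /=;
  [ apply: eq_psd (psd_legendre1 u) | apply: eq_psd (psd_legendre2 u)
  | apply: eq_psd (psd_legendre3 u) | apply: eq_psd (psd_legendre4 u)
  | apply: eq_psd (psd_legendre5 u) | apply: eq_psd (psd_legendre6 u)
  | apply: eq_psd (psd_legendre7 u) | by rewrite nth_nil; exact: psd0 ].
all: by move=> i j; rewrite /= !(zr0, zr_neg, zr_xO, zr_xI, zr_xH); ring.
Qed.

Lemma hev11 p : hev p 1 1 = zr (foldr Z.add Z0 p).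
Proof. by elim: p => //= c p ->; rewrite zrD expr1n mulr1 mul1r. Qed.

Lemma legendre16_at1 f : f \in features -> hev (nth [::] legendre16 f.1) 1 1 = 16.
Proof.
move=> ff; rewrite hev11.
suff /eqP -> : foldr Z.add Z0 (nth [::] legendre16 f.1) == Zpos 16 by [].
by move: f ff; apply/allP.
Qed.

Lemma hev_kernel n m x :
  hev (kernel n m) x 1 =
    16 * zr scale2 * n%:R ^+ 2 * m%:R ^+ 2 +
    \sum_(f <- features) zr (feature_at f.2 n) * zr (feature_at f.2 m) *
                         hev (nth [::] legendre16 f.1) x 1.
Proof.
rewrite /kernel; set b := (X in foldr _ X).
have hb : hev b x 1 = 16 * zr scale2 * n%:R ^+ 2 * m%:R ^+ 2.
  have hev0 k : hev (nseq k Z0) x 1 = 0.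
    by elim: k => //= k ->; rewrite zr0 mul0r mulr0 addr0.
  rewrite -[b]/(_ :: nseq 7 Z0) -[LHS]/(_ + _ * hev (nseq 7 Z0) x 1).
  by rewrite hev0 mulr0 addr0 expr1n mulr1 !zrM !zr_nat -!expr2.
have : size b = 8%N by [].
have : all (fun f => size (nth [::] legendre16 f.1) == 8%N) features by [].
move: b hb => b hb; elim: features => [_ _|f fs IH /andP[/eqP sf sfs] sb].
  by rewrite big_nil addr0.
rewrite big_cons /= hev_add_coefs; last first.
  rewrite size_map sf; elim: fs sfs {IH} => //= g fs IH /andP[/eqP sg sfs].
  by rewrite size_add_coefs size_map sg // IH.
by rewrite IH // hev_map zrM addrCA.
Qed.

Lemma kernel_sym n m x : hev (kernel n m) x 1 = hev (kernel m n) x 1.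
Proof.
rewrite !hev_kernel mulrAC; congr (_ + _).
by apply: eq_bigr => f _; rewrite [zr _ * zr _]mulrC.
Qed.

Lemma kernel_le0 n m x : (25 < n <= 64)%N -> (25 < m <= 64)%N ->
  -1 <= x -> x <= 1 - 2 * (n%:R / 90) * (m%:R / 90) -> hev (kernel n m) x 1 <= 0.
Proof.
wlog mn : n m / (m <= n)%N.
  move=> wlg n64 m64 x1 xnm; have [|/ltnW] := leqP m n; first by move/wlg; apply.
  by rewrite kernel_sym; move/wlg; apply=> //; rewrite mulrAC.
move=> n64 m64 x1 xnm.
have n_in : n \in iota 26 39 by rewrite mem_iota; lia.
have m_in : m \in iota 26 (n - 25) by rewrite mem_iota; lia.
pose k : R := 2 * (90 * 90 - n%:R * m%:R).
have k0 : 0 < k.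
  have [n64R m64R] : n%:R <= 64 :> R /\ m%:R <= 64 :> R by rewrite !ler_nat; lia.
  by rewrite mulr_gt0 // subr_gt0 (le_lt_trans (ler_pM _ _ n64R m64R)) ?ler0n //; lra.
have z8100 : zr (Zpos 8100) = 90 * 90 by rewrite -[90 : R]/(zr (Zpos 90)) -zrM.
have d0 : 90 * 90 != 0 :> R by rewrite mulf_neq0 // pnatr_eq0.
have x1' : 0 <= x + 1 by lra.
have := allP (allP kernel_certificate n n_in) m m_in; rewrite /kernel_ok => nok.
(* The ratio of the two coordinates is the [u] of the substitution in [kernel_ok]. *)
have {nok} := nonpos_on01P (x := (x + 1) / k) (y := (90 * 90)^-1) nok.
rewrite !(hev_rev, hev_dilate) hev_shift_coefs hev_dilate !mul1r z8100 mulfV //.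
rewrite zrN zrM zrD zrN zrM !zr_nat.
rewrite z8100 -[zr (Zpos 2)]/(2 : R) -/k -[zr (Zneg 1)]/(- 1 : R).
have -> : - 1 * (- k * ((x + 1) / k) + 1) = x by field; rewrite gt_eqF.
apply.
  by rewrite divr_ge0 // ltW.
have -> : (90 * 90)^-1 = (1 - (n%:R / 90) * (m%:R / 90)) * 2 / k.
  by apply: (mulIf (lt0r_neq0 k0)); rewrite divfK ?lt0r_neq0 // /k; field.
by rewrite ler_pM2r ?invr_gt0 //; lra.
Qed.

Lemma diagonal_le n : (25 < n <= 64)%N ->
  20 * (n - 25)%:R * hev (kernel n n) 1 1 <= 5421 * 16 * zr scale2 * n%:R ^+ 4.
Proof.
move=> n64; rewrite hev_kernel.
have -> : \sum_(f <- features) zr (feature_at f.2 n) * zr (feature_at f.2 n) *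
    hev (nth [::] legendre16 f.1) 1 1 =
    16 * \sum_(f <- features) zr (feature_at f.2 n) * zr (feature_at f.2 n).
  rewrite mulr_sumr big_seq [RHS]big_seq; apply: eq_bigr => f ff.
  by rewrite legendre16_at1 // mulrC.
have n_in : n \in iota 26 39 by rewrite mem_iota; lia.
have := allP diagonal_certificate n n_in; move/(zr_le R); rewrite !zrM zr_nat.
have fE t : zr (foldr (fun f v =>
      Z.add (Z.mul (feature_at f.2 n) (feature_at f.2 n)) v) t features) =
    zr t + \sum_(f <- features) zr (feature_at f.2 n) * zr (feature_at f.2 n).
  elim: features => [|f fs IH]; first by rewrite big_nil addr0.
  by rewrite big_cons /= zrD zrM IH addrCA.
rewrite fE !zrM !zr_nat -[zr (Zpos 20)]/(20 : R).
have -> : zr (Zpos 5421) = 39 * 139.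
  by rewrite -[39 : R]/(zr (Zpos 39)) -[139 : R]/(zr (Zpos 139)) -zrM.
move=> dn; rewrite -subr_ge0 in dn; rewrite -subr_ge0.
apply: le_trans (mulr_ge0 (ler0n R 16) dn) _.
(* [zr scale2] must be abstracted before [ring] computes it in unary. *)
by move: (zr scale2) (\sum_(f <- _) _) => sc sm; rewrite le_eqVlt; apply/predU1l; ring.
Qed.

(* As [25 + 64 = 90 - 1], the weights at [s] and [1 - s] sum to at least [1]. *)
Definition grid_cell (s : R) : nat := minn (Num.truncn (90 * s)) 64.

Definition weight (s : R) : R := (grid_cell s - 25)%:R / 39.

Lemma weight_ge0 s : 0 <= weight s.
Proof. by rewrite divr_ge0. Qed.

Lemma weight_compl s t : 0 <= s -> 0 <= t -> s + t = 1 -> 1 <= weight s + weight t.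
Proof.
move=> s0 t0 st; rewrite -mulrDl ler_pdivlMr // mul1r -natrD ler_nat.
have [n0 m0] : 0 <= 90 * s /\ 0 <= 90 * t by rewrite !mulr_ge0.
have /andP[_ ns] := truncn_itv n0; have /andP[_ mt] := truncn_itv m0.
(* Each truncation loses less than 1, so the two add up to at least 89; one capped at 64 already has
   weight 1. *)
have : 90 < ((Num.truncn (90 * s)).+1 + (Num.truncn (90 * t)).+1)%N%:R :> R.
  by rewrite natrD; lra.
rewrite ltr_nat /grid_cell; move: (Num.truncn _) (Num.truncn _) => a b; clear; lia.
Qed.

Lemma grid_cell_le s : 0 <= s -> (grid_cell s)%:R / 90 <= s.
Proof.
move=> s0; rewrite ler_pdivrMr // mulrC.
have /andP[ns _] := truncn_itv (mulr_ge0 (ler0n R 90) s0).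
by apply: le_trans ns; rewrite ler_nat geq_minl.
Qed.

Lemma weight_sum_le (I : finType) (x y z s : I -> R) :
  (forall i, x i ^+ 2 + y i ^+ 2 + z i ^+ 2 = 1) ->
  (forall i, 0 <= s i) ->
  (forall i j, i != j -> dot3 x y z i j <= 1 - 2 * s i * s j) ->
  \sum_i weight (s i) <= 139 / 20.
Proof.
have bound (T : R) : 0 <= T -> T ^+ 2 <= 5421 / 20 * T -> T / 39 <= 139 / 20.
  move=> T0 TT; rewrite leNgt; apply/negP => T2.
  have T3 : 5421 / 20 < T by lra.
  by nra.
move=> u s0 sep; pose n i := grid_cell (s i).
(* Dividing by [n^2] cancels the factor [n^2 m^2] built into [kernel]; at [n i = 0] both [a i] and
   [c i] are 0. *)
pose a i : R := (n i - 25)%:R; pose c i := a i / (n i)%:R ^+ 2.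
have a0 i : 0 <= a i by [].
have cn i : c i * (n i)%:R ^+ 2 = a i.
  have [ni|ni] := posnP (n i); last by rewrite divfK // expf_neq0 // pnatr_eq0 -lt0n.
  by rewrite /c /a ni !mul0r.
have n64 i : (n i <= 64)%N by rewrite geq_minr.
have an i : (n i <= 25)%N -> c i = 0.
  by rewrite /c /a -subn_eq0 => /eqP ->; rewrite mul0r.
pose K i j := hev (kernel (n i) (n j)) (dot3 x y z i j) 1.
have dot_ge i j : -1 <= dot3 x y z i j.
  rewrite /dot3; have := sqr_ge0 (x i + x j); have := sqr_ge0 (y i + y j).
  by have := sqr_ge0 (z i + z j); have := u i; have := u j; nra.
have dot_ii i : dot3 x y z i i = 1 by rewrite /dot3 -!expr2.
have K_off i j : i != j -> c i * c j * K i j <= 0.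
  move=> ij; have [/an ->|ni] := leqP (n i) 25; first by rewrite !mul0r.
  have [/an ->|nj] := leqP (n j) 25; first by rewrite mulr0 mul0r.
  rewrite mulr_ge0_le0 ?mulr_ge0 ?invr_ge0 ?exprn_ge0 //.
  apply: (kernel_le0 _ _ (dot_ge i j)); rewrite ?ni ?nj ?n64 //.
  apply: le_trans (sep _ _ ij) _.
  rewrite lerD2l lerN2.
  by rewrite ler_pM ?mulr_ge0 ?divr_ge0 ?ler_pM2l ?grid_cell_le ?invr_ge0.
have K_diag i : c i * c i * K i i <= 5421 / 20 * 16 * zr scale2 * a i.
  have [ni|ni] := leqP (n i) 25; first by rewrite an // !mul0r /a (eqP ni) mulr0.
  have := @diagonal_le (n i); rewrite ni n64 => /(_ isT); rewrite -/(a i).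
  move: (zr scale2) => sc; rewrite /K dot_ii; move: (hev _ _ _) => h.
  have nz : (n i)%:R != 0 :> R by rewrite pnatr_eq0 -lt0n (ltn_trans _ ni).
  rewrite /c; move: (n i)%:R nz (a i) (a0 i) => N N0 A A0 hA.
  rewrite -subr_ge0; have -> : 5421 / 20 * 16 * sc * A - A / N ^+ 2 * (A / N ^+ 2) * h =
    A / (20 * N ^+ 4) * (5421 * 16 * sc * N ^+ 4 - 20 * A * h) by field.
  rewrite mulr_ge0 ?subr_ge0 // divr_ge0 // mulr_ge0 //.
  by rewrite -[4%N]/(2 * 2)%N exprM sqr_ge0.
have sc0 : 0 < zr scale2 := zr_gt0 R _.
have upper : \sum_i \sum_j c i * c j * K i j <= 5421 / 20 * 16 * zr scale2 * \sum_i a i.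
  rewrite mulr_sumr; apply: ler_sum => i _.
  rewrite (bigD1 i) //= -[leRHS]addr0 lerD //.
  by rewrite sumr_le0 // => j ji; rewrite K_off // eq_sym.
have lower : 16 * zr scale2 * (\sum_i a i) ^+ 2 <= \sum_i \sum_j c i * c j * K i j.
  (* The constant term of the kernel yields the square of the sum; the Legendre terms are
     nonnegative. *)
  have -> : \sum_i \sum_j c i * c j * K i j =
      16 * zr scale2 * (\sum_i a i) ^+ 2 + \sum_(f <- features)
        \sum_i \sum_j (c i * zr (feature_at f.2 (n i))) *
          (c j * zr (feature_at f.2 (n j))) *
          hev (nth [::] legendre16 f.1) (dot3 x y z i j) 1.
    rewrite [X in _ + X]exchange_big /=.
    under [X in _ + X]eq_bigr => i _ do rewrite exchange_big /=.
    rewrite expr2 mulr_suml mulr_sumr -big_split; apply: eq_bigr => i _ /=.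
    rewrite mulr_sumr mulr_sumr -big_split; apply: eq_bigr => j _ /=.
    rewrite /K hev_kernel mulrDr; congr (_ + _).
      by move: (zr scale2) => sc; rewrite -(cn i) -(cn j); ring.
    by rewrite mulr_sumr; apply: eq_bigr => f _; ring.
  rewrite lerDl big_seq sumr_ge0 // => f _.
  exact: (psd_legendre _ u).
have : 16 * zr scale2 * (\sum_i a i) ^+ 2 <= 5421 / 20 * 16 * zr scale2 * \sum_i a i.
  exact: le_trans upper.
have -> : \sum_i weight (s i) = (\sum_i a i) / 39 by rewrite mulr_suml.
have : 0 <= \sum_i a i by rewrite sumr_ge0.
move: (\sum_i a i) (zr scale2) sc0 => T sc sc0 T0 hT.
have {}hT : T ^+ 2 <= 5421 / 20 * T.
  rewrite -(ler_pM2l (x := 16 * sc)) ?mulr_gt0 //.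
  by apply: le_trans hT _; rewrite le_eqVlt; apply/predU1l; ring.
exact: bound.
Qed.

End Neighbourhood.

(** * Counting edges by weights on ordered pairs *)

Section DoubleCounting.
Variables (R : realFieldType) (V : finType) (adj : rel V) (w : V -> V -> R).

(** The total weight of adjacent ordered pairs is at most [M] per first vertex, while each edge
    receives at least 1 from its two orientations. *)
Lemma card_edges_le (M : R) :
  symmetric adj -> (forall u v, 0 <= w u v) ->
  (forall u v, u != v -> adj u v -> 1 <= w u v + w v u) ->
  (forall u, \sum_(v | (u != v) && adj u v) w u v <= M) ->
  #|edges adj|%:R <= M * #|V|%:R.
Proof.
move=> adj_sym w0 w1 wM.
have -> : M * #|V|%:R = \sum_(u : V) M by rewrite sumr_const mulr_natr.
apply: le_trans (ler_sum _ (fun u _ => wM u)).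
rewrite pair_big_dep /=
  (partition_big (fun p : V * V => [set p.1; p.2]%SET) (mem (edges adj))).
  rewrite -sum1_card natr_sum; apply: ler_sum => E.
  rewrite inE => /existsP[u /existsP[v /and3P[uv auv /eqP ->]]].
  rewrite (bigD1 (u, v)) /= ?uv ?auv ?eqxx //.
  have vu : v != u by rewrite eq_sym.
  have avu : adj v u by rewrite adj_sym.
  rewrite (bigD1 (v, u)) /=; last first.
    by rewrite vu avu finset.setUC eqxx xpair_eqE (negPf vu).
  by rewrite addrA -[leLHS]addr0 lerD ?w1 // sumr_ge0.
case=> u v /= /andP[uv auv]; rewrite inE; apply/existsP; exists u.
by apply/existsP; exists v; rewrite uv auv eqxx.
Qed.

End DoubleCounting.

(** * Distances between centres in a packing *)

Section BallGeometry.
Variables (R : realType) (d : nat).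
Implicit Types (b c : 'rV[R]_d * R) (x y : 'rV[R]_d).

Definition sqdist x y : R := \sum_(i < d) (x ord0 i - y ord0 i) ^+ 2.

Lemma edist_le x y r : 0 <= r -> (Defs.edist x y <= r) = (sqdist x y <= r ^+ 2).
Proof.
move=> r0; rewrite /Defs.edist -[RHS]ler_sqrt ?exprn_ge0 //.
by rewrite [in RHS]sqrtr_sqr ger0_norm.
Qed.

Lemma edist_lt x y r : 0 < r -> (Defs.edist x y < r) = (sqdist x y < r ^+ 2).
Proof.
move=> r0; rewrite /Defs.edist -[RHS]ltr_sqrt ?exprn_gt0 //.
by rewrite [in RHS]sqrtr_sqr ger0_norm ?ltW.
Qed.

Lemma edist_continuous x : continuous (@Defs.edist R d x).
Proof.
move=> y; apply: continuous_comp; last exact: sqrt_continuous.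
apply: continuous_big => [|i _ {}y]; first exact: add_continuous.
have cs : {for y, continuous (fun t : 'rV[R]_d => x ord0 i - t ord0 i)}.
  by apply: continuousB; [exact: cst_continuous | exact: coord_continuous].
exact: (cvgM cs cs).
Qed.

Lemma interior_eball b x : Defs.edist b.1 x < b.2 -> interior (eball b) x.
Proof.
move=> bx; have near_bx : \forall y \near x, Defs.edist b.1 y < b.2.
  exact: (cvgr_lt _ (@edist_continuous b.1 x) _ bx).
by apply: filterS near_bx => y /ltW.
Qed.

(** If the centres were closer, the point dividing their segment in the ratio of the radii would be
    interior to both balls. *)
Lemma packing_sqdist (P : {fset 'rV[R]_d * R}) b c :
  is_packing P -> b \in P -> c \in P -> b != c ->
  (b.2 + c.2) ^+ 2 <= sqdist b.1 c.1.
Proof.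
move=> [_ pos disj] bP cP bc; have b0 := pos _ bP; have c0 := pos _ cP.
rewrite leNgt; apply/negP => D.
have s0 : 0 < b.2 + c.2 by rewrite addr_gt0.
pose t := b.2 / (b.2 + c.2); pose p := b.1 + t *: (c.1 - b.1).
suff : (interior (eball b) `&` interior (eball c)) p by rewrite disj.
have pb : sqdist b.1 p = t ^+ 2 * sqdist b.1 c.1.
  by rewrite /sqdist mulr_sumr; apply: eq_bigr => i _; rewrite !mxE; ring.
have pc : sqdist c.1 p = (1 - t) ^+ 2 * sqdist b.1 c.1.
  by rewrite /sqdist mulr_sumr; apply: eq_bigr => i _; rewrite !mxE; ring.
have tE : t * (b.2 + c.2) = b.2 by rewrite divfK // gt_eqF.
have t'E : (1 - t) * (b.2 + c.2) = c.2 by rewrite mulrBl tE mul1r addrC addKr.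
have t0 : 0 < t by rewrite divr_gt0.
have t1 : 0 < 1 - t by rewrite -(pmulr_lgt0 _ s0) t'E.
split; apply: interior_eball; rewrite edist_lt //.
  by rewrite pb -[X in _ < X ^+ 2]tE [X in _ < X]exprMn ltr_pM2l ?exprn_gt0.
by rewrite pc -[X in _ < X ^+ 2]t'E [X in _ < X]exprMn ltr_pM2l ?exprn_gt0.
Qed.

Lemma tangent_sym b c : tangent b c -> tangent c b.
Proof. by move=> [p bcp]; exists p; rewrite setIC. Qed.

(** The triangle inequality through the contact point. With [packing_sqdist] it puts tangent centres
    exactly [b.2 + c.2] apart. *)
Lemma tangent_sqdist_le b c :
  0 < b.2 -> 0 < c.2 -> tangent b c -> sqdist b.1 c.1 <= (b.2 + c.2) ^+ 2.
Proof.
move=> b0 c0 [p bcp]; have [] : (eball b `&` eball c) p by rewrite bcp.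
rewrite /eball /= (edist_le _ _ (ltW b0)) (edist_le _ _ (ltW c0)) => bp cp.
(* AM-GM: [2 u v <= (c / b) u^2 + (b / c) v^2] for the coordinates of the two legs *)
apply: (@le_trans _ _ ((1 + c.2 / b.2) * sqdist b.1 p +
                       (1 + b.2 / c.2) * sqdist c.1 p)).
  rewrite /sqdist !mulr_sumr -big_split; apply: ler_sum => i _ /=.
  move: (b.2) (c.2) b0 c0 {bp cp bcp} => r s r0 s0.
  rewrite -subr_ge0; set u := b.1 _ _; set v := c.1 _ _; set t := p _ _.
  have -> : (1 + s / r) * (u - t) ^+ 2 + (1 + r / s) * (v - t) ^+ 2 - (u - v) ^+ 2 =
      (s * (u - t) + r * (v - t)) ^+ 2 / (r * s) by field; rewrite !gt_eqF.
  by rewrite divr_ge0 ?sqr_ge0 // mulr_ge0 // ltW.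
have -> : (b.2 + c.2) ^+ 2 =
    (1 + c.2 / b.2) * b.2 ^+ 2 + (1 + b.2 / c.2) * c.2 ^+ 2.
  by field; rewrite !gt_eqF.
by rewrite lerD // ler_wpM2l // addr_ge0 // divr_ge0 // ltW.
Qed.

End BallGeometry.

(** * Contact graphs in dimension three *)

Section AverageDegree.
Variable R : realType.
Implicit Types b c : 'rV[R]_3 * R.

Definition radius_ratio b c : R := c.2 / (b.2 + c.2).

Lemma radius_ratio_ge0 b c : 0 < b.2 -> 0 < c.2 -> 0 <= radius_ratio b c.
Proof. by move=> b0 c0; rewrite divr_ge0 ?addr_ge0 // ltW. Qed.

Lemma radius_ratio_compl b c :
  0 < b.2 -> 0 < c.2 -> radius_ratio b c + radius_ratio c b = 1.
Proof. by move=> b0 c0; rewrite /radius_ratio; field; rewrite !gt_eqF ?addr_gt0. Qed.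

Lemma sqdist3 (x y : 'rV[R]_3) : sqdist x y = (x ord0 0 - y ord0 0) ^+ 2 +
  (x ord0 1 - y ord0 1) ^+ 2 + (x ord0 2 - y ord0 2) ^+ 2.
Proof.
rewrite /sqdist !big_ord_recl big_ord0 addr0 addrA.
by congr (_ + (x _ _ - y _ _) ^+ 2 + (x _ _ - y _ _) ^+ 2); apply: val_inj.
Qed.

Lemma neighbour_weight_le (P : {fset 'rV[R]_3 * R}) (u : P) :
  is_packing P ->
  \sum_(v : P | (u != v) && contact_graph u v)
     weight (radius_ratio (val u) (val v)) <= 139 / 20.
Proof.
move=> packP; have [_ pos _] := packP.
have pos' (v : P) : 0 < (val v).2 by apply: pos; exact: valP.
pose nbr := [pred v : P | (u != v) && contact_graph u v].
(* The neighbours become a finite type, as [weight_sum_le] requires. *)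
rewrite (big_sub nbr (fun v => weight (radius_ratio (val u) (val v)))).
pose b := val u; pose c (i : {v : P | v \in nbr}) := val (val i).
pose A k i : R := (c i).1 ord0 k - b.1 ord0 k.
pose e k i : R := A k i / (b.2 + (c i).2).
have b0 : 0 < b.2 := pos' _.
have c0 i : 0 < (c i).2 := pos' _.
have r0 i : b.2 + (c i).2 != 0 by rewrite gt_eqF // addr_gt0.
have A_norm i : A 0 i ^+ 2 + A 1 i ^+ 2 + A 2 i ^+ 2 = (b.2 + (c i).2) ^+ 2.
  have /andP[bc /asboolP tbc] := valP i.
  have <- : sqdist (c i).1 b.1 = (b.2 + (c i).2) ^+ 2; last by rewrite sqdist3.
  rewrite addrC; apply/eqP; rewrite eq_le; apply/andP; split.
    exact: tangent_sqdist_le (c0 i) b0 (tangent_sym tbc).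
  apply: (packing_sqdist packP); [exact: valP | exact: valP |].
  by rewrite (inj_eq val_inj) eq_sym.
apply: (@weight_sum_le _ _ (e 0) (e 1) (e 2)) => [i|i|i j ij].
- rewrite /e !expr_div_n -!mulrDl A_norm divff // expf_neq0 //.
- by rewrite radius_ratio_ge0 // pos'.
have := packing_sqdist packP (valP (val i)) (valP (val j)).
rewrite !(inj_eq val_inj) -!/(c _) => /(_ ij); rewrite sqdist3.
have Ai := A_norm i; have Aj := A_norm j.
have cA k : (c i).1 ord0 k - (c j).1 ord0 k = A k i - A k j by rewrite /A; ring.
rewrite !cA => sep; rewrite /dot3 /e /radius_ratio -/b -!/(c _).
move: (A 0 i) (A 1 i) (A 2 i) (A 0 j) (A 1 j) (A 2 j) Ai Aj sep.
move: (r0 i) (r0 j) (c0 i) (c0 j); move: (b.2) ((c i).2) ((c j).2) b0.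
move=> r s t r_gt0 rs rt s_gt0 t_gt0 x y z x' y' z' Ai Aj sep.
rewrite -subr_ge0.
have -> : 1 - 2 * (s / (r + s)) * (t / (r + t)) - (x / (r + s) * (x' / (r + t)) +
    y / (r + s) * (y' / (r + t)) + z / (r + s) * (z' / (r + t))) =
  ((r + s) * (r + t) - 2 * s * t - (x * x' + y * y' + z * z')) / ((r + s) * (r + t)).
  by field; rewrite rs rt.
apply: divr_ge0; last by rewrite mulr_ge0 // addr_ge0 // ltW.
(* Law of cosines: [sep] is expanded with the vectors of lengths [r + s] and [r + t]. *)
by nra.
Qed.

Lemma average_degree_le (P : {fset 'rV[R]_3 * R}) :
  is_packing P -> average_degree (@contact_graph R 3 P) R <= 139 / 10.
Proof.
move=> packP; have [P0 pos _] := packP.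
have pos' (v : P) : 0 < (val v).2 by apply: pos; exact: valP.
have : #|edges (@contact_graph R 3 P)|%:R <= (139 / 20) * #|{: P}|%:R :> R.
  apply: (card_edges_le
    (w := fun u v : P => weight (radius_ratio (val u) (val v)))).
  - by move=> u v; apply/asboolP/asboolP; exact: tangent_sym.
  - by move=> u v; exact: weight_ge0.
  - move=> u v _ _; apply: weight_compl; rewrite ?radius_ratio_ge0 //.
    exact: radius_ratio_compl.
  - by move=> u; exact: neighbour_weight_le.
rewrite /average_degree => E; rewrite ler_pdivrMr ?natrM; first by lra.
by rewrite ltr0n -cardfE.
Qed.

End AverageDegree.

Theorem corollary2 (R : realType) :
  (kd R 3 < (1392%:R / 100%:R : R)%R%:E)%E.
Proof.
apply: (@le_lt_trans _ _ (139 / 10 : R)%:E); last by rewrite lte_fin; lra.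
apply: ge_ereal_sup => _ [P packP <-].
by rewrite lee_fin average_degree_le.
Qed.
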